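(* Let $\mathbf{L}$ be a complete De Morgan Heyting algebra and $U$ a set. Let $\mathcal{U}$ be an $L$-fuzzy operator on $U$ and let $\mathcal{T}_1,\dots,\mathcal{T}_m$ be $L$-fuzzy operators on $U$ such that $\mathcal{U}\geq\mathcal{T}_k$ for every $1\leq k\leq m$. Then there exists a unique $L$-relation $R$ on $U$ such that $\mathsf{U}_R(A)=\mathcal{U}(A)$ for all $A\in\mathcal{F}_L(U)$ if and only if $$\mathcal{U}\Big(\overline{a}\wedge\bigvee_{i\in I} A_i\Big)=\overline{a}\wedge\bigvee_{i\in I}\big(\mathcal{U}(A_i)\vee\mathcal{T}_1(A_i)\vee\cdots\vee\mathcal{T}_m(A_i)\big)$$ for all $a\in L$ and all families $\{A_i\}_{i\in I}\subseteq\mathcal{F}_L(U)$.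
   Context: A De Morgan Heyting algebra is an algebra $\mathbf{L}=(L,\vee,\wedge,\Rightarrow,{}',0,1)$ such that $(L,\vee,\wedge,\Rightarrow,0,1)$ is a Heyting algebra and $'$ satisfies $(x\wedge y)'=x'\vee y'$ and $x''=x$ for all $x,y\in L$. It is called complete if its underlying lattice is complete. An $L$-set on $U$ is a map $A\colon U\to L$; $\mathcal{F}_L(U)$ is the set of all $L$-sets on $U$, with order, $\wedge$, $\vee$ and $\bigvee$ defined pointwise. An $L$-relation on $U$ is a map $R\colon U\times U\to L$, and its upper $L$-approximation operator is $\mathsf{U}_R(A)(x)=\bigvee_{y\in U}(R(x,y)\wedge A(y))$. For $a\in L$, $\overline{a}\in\mathcal{F}_L(U)$ is the constant map with value $a$. An $L$-fuzzy operator on $U$ is any map $\mathcal{F}_L(U)\to\mathcal{F}_L(U)$; for such operators $\mathcal{U}\geq\mathcal{T}$ means $\mathcal{U}(A)\geq\mathcal{T}(A)$ for all $A\in\mathcal{F}_L(U)$. *)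

(* Defs.v *)
From HB Require Import structures.
From mathcomp Require Import all_boot all_order.
From mathcomp Require Import boolp classical_sets.

Set Implicit Arguments.
Unset Strict Implicit.
Unset Printing Implicit Defensive.

Import Order.Theory.
Local Open Scope order_scope.

HB.mixin Record isHeyting (d : Order.disp_t) L of Order.TBLattice d L := {
  himp : L -> L -> L;
  himpP : forall x y z : L, (z <= himp x y) = (z `&` x <= y)
}.

#[short(type="heytingType")]
HB.structure Definition Heyting (d : Order.disp_t) :=
  {L of isHeyting d L & Order.TBLattice d L}.

HB.mixin Record isDeMorgan (d : Order.disp_t) L of Order.TBLattice d L := {
  dneg : L -> L;
  dnegI : forall x y : L, dneg (x `&` y) = dneg x `|` dneg y;
  dnegK : forall x : L, dneg (dneg x) = x
}.

#[short(type="deMorganHeytingType")]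
HB.structure Definition DeMorganHeyting (d : Order.disp_t) :=
  {L of isDeMorgan d L & Heyting d L}.

Definition complete_lattice (d : Order.disp_t) (L : latticeType d) : Prop :=
  forall S : set L, (supremums S !=set0)%classic /\ (infimums S !=set0)%classic.

(* The supremum of the empty family is [\bot]; when the range of [F] has no
   supremum (impossible in a complete lattice) the value is unspecified. *)
Definition joins (d : Order.disp_t) (L : tbLatticeType d) (I : Type)
    (F : I -> L) : L :=
  supremum \bot (range F).

(* [L]-sets are plain functions [U -> L], for which [boolp] provides the
   pointwise order, meet and join; the least element is added here so that
   finite joins [\join_] of [L]-sets make sense. *)
Section FunBottom.
Variables (U : Type) (d : Order.disp_t) (L : tbLatticeType d).

Fact fun_bot_le (A : U -> L) : (fun=> \bot) <= A.
Proof. by apply/asboolP => x; exact: le0x. Qed.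

HB.instance Definition _ :=
  Order.hasBottom.Build FunOrder.fun_display (U -> L) fun_bot_le.

End FunBottom.

Definition Ljoins (U : Type) (d : Order.disp_t) (L : tbLatticeType d)
    (I : Type) (A : I -> U -> L) : U -> L :=
  fun x => joins (fun i => A i x).

Definition Lconst (U : Type) (d : Order.disp_t) (L : tbLatticeType d) (a : L) :
    U -> L :=
  fun=> a.

Definition upper (U : Type) (d : Order.disp_t) (L : tbLatticeType d)
    (R : U * U -> L) : (U -> L) -> (U -> L) :=
  fun A x => joins (fun y => R (x, y) `&` A y).

(* Main.v *)
(* Since T_k <= U, the joins with T_1, ..., T_m are absorbed, so the condition
   says that U commutes with arbitrary joins and with meets by constants. Upper
   approximation operators have this property by the infinite distributive law
   of complete Heyting algebras. Conversely every L-set A is the join of the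
   L-sets A(y) /\ 1_y, so such an operator is determined by its values on the
   singletons 1_y, and R(x, y) = U(1_y)(x) is the only possible choice. *)

Require Import Defs.
From HB Require Import structures.
From mathcomp Require Import all_boot all_order.
From mathcomp Require Import boolp classical_sets.

Set Implicit Arguments.
Unset Strict Implicit.
Unset Printing Implicit Defensive.

Import Order.Theory.
Local Open Scope order_scope.

Section Joins.
Context (d : Order.disp_t) (L : tbLatticeType d) (complL : complete_lattice L).

(** This universal property is the interface through which values of [joins] are computed;
    completeness guarantees that the chosen supremum exists. *)
Lemma joins_le (I : Type) (F : I -> L) (z : L) :
  (joins F <= z) <-> (forall i, F i <= z).
Proof.
(* An empty range forces [I] to be empty: the default value [\bot] lies below [z], and the bound on
   all [F i] is vacuous. *)
rewrite /joins /supremum; case: ifPn => [/eqP range0|_].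
  split=> [_ i|_]; last exact: le0x.
  by have := imageT F i; rewrite range0.
have := xgetPex \bot (complL (range F)).1.
move: (xget _ _) => s [ub lub]; split=> [sz i|Fz].
  by apply: le_trans sz; apply: ub; exists i.
by apply: lub => _ [i _ <-].
Qed.

Lemma joins_ub (I : Type) (F : I -> L) (i : I) : F i <= joins F.
Proof. exact: (joins_le F (joins F)).1. Qed.

Lemma joins_eq (I : Type) (F : I -> L) (s : L) :
  (forall z, (s <= z) <-> (forall i, F i <= z)) -> joins F = s.
Proof.
move=> sP; apply/eqP; rewrite eq_le; apply/andP; split.
  by apply/joins_le/sP.
by apply/sP => i; apply: joins_ub.
Qed.

Lemma eq_joins (I : Type) (F G : I -> L) : F =1 G -> joins F = joins G.
Proof. by move=> FG; congr joins; apply/funext. Qed.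

Lemma joins_unit (F : unit -> L) : joins F = F tt.
Proof. by apply: joins_eq => z; split=> [Fz []|]. Qed.

Lemma joins_exchange (I J : Type) (F : I -> J -> L) :
  joins (fun i => joins (F i)) = joins (fun j => joins (F^~ j)).
Proof.
apply: joins_eq => z; rewrite joins_le.
split=> [Fz i|Fz j]; apply/joins_le => k.
  by have /joins_le := Fz k; apply.
by have /joins_le := Fz k; apply.
Qed.

(** Equality is tested classically because [U] is an arbitrary type. *)
Definition singleton (U : Type) (y : U) : U -> L :=
  fun z => if `[< z = y >] then \top else \bot.

Lemma joins_singleton (U : Type) (F : U -> L) (y : U) :
  joins (fun z => F z `&` singleton y z) = F y.
Proof.
apply: joins_eq => t; rewrite /singleton; split=> [Fyt z|/(_ y)].
  by case: asboolP => [->|_]; rewrite ?meetx1 ?meetx0 ?le0x.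
by rewrite asboolT // meetx1.
Qed.

Lemma upper_singleton (U : Type) (R : U * U -> L) (x y : U) :
  upper R (singleton y) x = R (x, y).
Proof. exact: (joins_singleton (fun z => R (x, z))). Qed.

Lemma Ljoins_singleton (U : Type) (A : U -> L) :
  Ljoins (fun y => Lconst (A y) `&` singleton y) = A.
Proof.
apply/funext => x; rewrite -[RHS](joins_singleton A x); apply: eq_joins => y.
by rewrite /singleton (_ : (y = x) = (x = y)) //; apply/propext; split.
Qed.

End Joins.

(** By residuation, meeting with [a] is left adjoint to [himp a], hence preserves joins. *)
Lemma meet_joins (d : Order.disp_t) (L : heytingType d)
    (complL : complete_lattice L) (I : Type) (a : L) (F : I -> L) :
  a `&` joins F = joins (fun i => a `&` F i).
Proof.
apply/esym/(joins_eq complL) => z.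
rewrite meetC -himpP (joins_le complL).
by split=> Fz i; have := Fz i; rewrite himpP meetC.
Qed.

Lemma upper_meet_Ljoins (d : Order.disp_t) (L : heytingType d)
    (complL : complete_lattice L) (U I : Type) (R : U * U -> L) (a : L)
    (A : I -> U -> L) :
  upper R (Lconst a `&` Ljoins A) =
  Lconst a `&` Ljoins (fun i => upper R (A i)).
Proof.
apply/funext => x.
rewrite [RHS](_ : _ = a `&` joins (fun i => upper R (A i) x)) //.
(* Once the join over [y] is outermost on both sides, it suffices to compare the terms for each [y],
   where [R (x, y)] is pulled out of the join over [i]. *)
rewrite /upper (joins_exchange complL) (meet_joins complL).
apply: eq_joins => y; rewrite -(meet_joins complL) meetCA; congr (_ `&` _).
Qed.

Theorem theorem4p6 (d : Order.disp_t) (L : deMorganHeytingType d)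
    (complL : complete_lattice L) (U : Type)
    (Uop : (U -> L) -> (U -> L))
    (m : nat) (Top : 'I_m -> (U -> L) -> (U -> L))
    (UT : forall (k : 'I_m) (A : U -> L), Top k A <= Uop A) :
  (exists! R : U * U -> L, forall A : U -> L, upper R A = Uop A) <->
  (forall (a : L) (I : Type) (A : I -> U -> L),
     Uop (Lconst a `&` Ljoins A) =
     Lconst a `&`
       Ljoins (fun i => Uop (A i) `|` \join_(k < m) Top k (A i))).
Proof.
have absorb A : Uop A `|` \join_(k < m) Top k A = Uop A.
  by apply: join_l; apply/joinsP => k _; exact: UT.
have absorbJ (I : Type) (A : I -> U -> L) :
    Ljoins (fun i => Uop (A i) `|` \join_(k < m) Top k (A i)) =
    Ljoins (fun i => Uop (A i)).
  by congr Ljoins; apply/funext => i; exact: absorb.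
split=> [[R [UR _]] a I A|UopP].
  rewrite absorbJ.
  have -> : Uop = upper R by apply/funext => B; rewrite UR.
  exact: upper_meet_Ljoins.
(* A family indexed by [unit] isolates the constant in the hypothesis. *)
have UopM a B : Uop (Lconst a `&` B) = Lconst a `&` Uop B.
  have unitE (C : U -> L) : Ljoins (fun _ : unit => C) = C.
    by apply/funext => x; exact: joins_unit.
  by have := UopP a unit (fun=> B); rewrite absorbJ !unitE.
(* Taking the constant [\top] isolates the join; the index type [U] is the one of the decomposition
   into singletons. *)
have UopJ (A : U -> U -> L) : Uop (Ljoins A) = Ljoins (fun y => Uop (A y)).
  have top_meet (B : U -> L) : Lconst \top `&` B = B.
    by apply/funext => x; exact: meet1x.
  by have := UopP \top U A; rewrite absorbJ !top_meet.
exists (fun p => Uop (singleton L p.2) p.1); split=> [A|R UR].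
  rewrite -[in RHS](Ljoins_singleton complL A) UopJ.
  apply/funext => x; apply: eq_joins => y /=.
  by rewrite UopM meetC.
by apply/funext => -[x y] /=; rewrite -UR upper_singleton.
Qed.
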